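(* Let $d\ge 1$ and let $G=(V,E)$ be a connected $k$-regular graph with at most $d+1$ distinct eigenvalues. Let $k=\theta_0>\theta_1>\cdots>\theta_s$ (with $s\le d$) be the distinct eigenvalues of $G$, let $E_i$ be the orthogonal projection matrix onto the eigenspace corresponding to $\theta_i$, and for $i\in\{1,\ldots,s\}$ put \[ K_i=\prod_{j=1,2,\ldots,s,\ j\ne i}\frac{\theta_0-\theta_j}{\theta_i-\theta_j}. \] Assume that $|V|>M(k,d-1)$. Then the following hold. (1) $G$ has diameter $d$. (2) $G$ has exactly $d+1$ distinct eigenvalues (that is, $s=d$). (3) For every pair $x,y\in V$ with $\partial(x,y)=d$ and every $i\in\{1,\ldots,d\}$, the $(x,y)$-entry of $E_i$ is $-K_i/|V|$. (4) For each $x\in V$ and each $i\in\{1,\ldots,d\}$, the number of entries equal to $-K_i/|V|$ in the $x$-th row of $E_i$ is at least $|V|-M(k,d-1)$.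
   Context: Graphs are finite, simple and undirected. The eigenvalues and eigenspaces of $G$ are those of its adjacency matrix (a real symmetric matrix indexed by $V$); the matrices $E_i$ are indexed by $V$. $\partial(x,y)$ denotes the path distance between the vertices $x$ and $y$. For an integer $e\ge 0$, the Moore bound is \[ M(k,e)=1+k\sum_{j=0}^{e-1}(k-1)^j, \] where $(k-1)^0=1$ and the empty sum is $0$ (so $M(k,0)=1$). An empty product is $1$. *)

(* Defs.v *)
From mathcomp Require Import all_boot all_order all_algebra.

Set Implicit Arguments.
Unset Strict Implicit.
Unset Printing Implicit Defensive.

Import Order.TTheory GRing.Theory Num.Theory.

Local Open Scope ring_scope.

(* A graph is a symmetric irreflexive relation [e] on a finite type [V].      *)

Definition connected (V : finType) (e : rel V) : Prop :=
  (0 < #|V|)%N /\ forall x y : V, connect e x y.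

Definition regular (V : finType) (e : rel V) (k : nat) : Prop :=
  forall x : V, #|[set y | e x y]| = k.

Definition walk (V : finType) (e : rel V) (n : nat) (x y : V) : bool :=
  [exists p : n.-tuple V, path e x p && (last x p == y)].

(* Least length of a walk from x to y. Lengths below #|V| suffice: a shortest *)
(* walk has distinct vertices. The value is #|V| when y is unreachable.       *)
Definition dist (V : finType) (e : rel V) (x y : V) : nat :=
  find (fun n => walk e n x y) (iota 0 #|V|).

Definition diameter (V : finType) (e : rel V) : nat :=
  \max_(x : V) \max_(y : V) dist e x y.

Definition moore (k e : nat) : nat := (1 + k * \sum_(j < e) (k - 1) ^ j)%N.

(* Matrices over 'I_#|V| are read as indexed by V through enum_rank/enum_val. *)
Definition adjacency (R : fieldType) (V : finType) (e : rel V) : 'M[R]_#|V| :=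
  \matrix_(i, j) (e (enum_val i) (enum_val j))%:R.

(* Projection onto the row space of W parallel to its orthogonal complement   *)
(* {u | u *m W^T = 0}; over a real field the two are always supplementary.    *)
Definition orth_proj (R : realFieldType) (n : nat) (W : 'M[R]_n) : 'M[R]_n :=
  proj_mx W (kermx W^T).

Definition eigenproj (R : realFieldType) (V : finType) (e : rel V) (a : R)
    (x y : V) : R :=
  orth_proj (eigenspace (adjacency R e) a) (enum_rank x) (enum_rank y).

Definition Kcoef (R : fieldType) (s : nat) (theta : 'I_s.+1 -> R)
    (i : 'I_s.+1) : R :=
  \prod_(j < s.+1 | (j != ord0) && (j != i))
    ((theta ord0 - theta j) / (theta i - theta j)).

(* Main.v *)
(* Let A be the adjacency matrix and L_i the Lagrange polynomial of degree s
   with L_i(theta_j) = [i = j]. As A is symmetric, E_i = L_i(A); as the graph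
   is connected and regular, E_0 = J/|V|. If dist(x, y) > s, all powers A^m
   with m <= s vanish at (x, y), so E_0 would too: hence the diameter is at
   most s <= d. A ball of radius d - 1 has at most M(k, d - 1) < |V| points,
   so every x has a vertex at distance at least d, and s = d. If dist(x, y) =
   d, only the leading term of L_i contributes to (E_i)_xy, so (E_i)_xy /
   (E_0)_xy is the ratio of the leading coefficients of L_i and L_0, namely
   -K_i. *)

Require Import Defs.
From mathcomp Require Import all_boot all_order all_algebra.
From mathcomp Require Import complex ring zify.

Set Implicit Arguments.
Unset Strict Implicit.
Unset Printing Implicit Defensive.

Import Order.TTheory GRing.Theory Num.Theory.

Local Open Scope ring_scope.

(** * Polynomials in a symmetric matrix *)

Lemma horner_mx_eigenvector (F : fieldType) n m (A : 'M[F]_n.+1)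
    (p : {poly F}) (a : F) (W : 'M[F]_(m, n.+1)) :
  W *m A = a *: W -> W *m horner_mx A p = p.[a] *: W.
Proof.
move=> WA; elim/poly_ind: p => [|p c IH].
  by rewrite rmorph0 mulmx0 horner0 scale0r.
rewrite rmorphD rmorphM /= horner_mx_X horner_mx_C mulmxDr mulmxA IH.
by rewrite -scalemxAl WA mul_mx_scalar scalerA !hornerE scalerDl.
Qed.

Lemma horner_mx_trmx (F : fieldType) n (A : 'M[F]_n.+1) (p : {poly F}) :
  (horner_mx A p)^T = horner_mx A^T p.
Proof.
elim/poly_ind: p => [|p c IH]; first by rewrite !rmorph0 trmx0.
rewrite !rmorphD !rmorphM /= !horner_mx_X !horner_mx_C -!mulmxE.
rewrite linearD /= trmx_mul IH tr_scalar_mx; congr (_ + _).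
by have := comm_mx_horner p (comm_mx_refl A^T).
Qed.

Lemma horner_mx_sum (F : fieldType) n (A : 'M[F]_n.+1) (p : {poly F}) m :
  (size p <= m)%N -> horner_mx A p = \sum_(j < m) p`_j *: A ^+ j.
Proof.
move=> sp; have -> : p = \poly_(j < m) p`_j.
  apply/polyP=> i; rewrite coef_poly; case: ltnP => // mi.
  by rewrite nth_default // (leq_trans sp).
rewrite [in LHS]poly_def rmorph_sum; apply: eq_bigr => i _ /=.
by rewrite horner_mxZ rmorphXn /= horner_mx_X coef_poly ltn_ord.
Qed.

(** Over the complex extension of [R] the matrix becomes Hermitian, so it is conjugate to a diagonal
    matrix with real entries. Each of these is an eigenvalue of [A], hence a root of [p], so [p]
    kills the diagonal form. *)
Lemma horner_mx_sym_eq0 (R : rcfType) n (A : 'M[R]_n.+1) (p : {poly R}) :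
  A^T = A -> (forall a, eigenvalue A a -> root p a) -> horner_mx A p = 0.
Proof.
move=> As Ap; pose f := real_complex R; pose B := map_mx f A.
have Bh : B \is hermsymmx.
  apply: realsym_hermsym.
    by apply/is_hermitianmxP; rewrite expr0 scale1r map_mx_id // map_trmx As.
  by apply/mxOverP=> i j; rewrite mxE; apply/complex_realP; exists (A i j).
have /hermitian_normalmx /orthomx_spectralP BE := Bh.
have Dr := hermitian_spectral_diag_real Bh.
have Pu := spectral_unit B.
set P := spectralmx B in BE Pu; set D := spectral_diag B in BE Dr.
apply: (map_mx_inj (f := f)); rewrite map_horner_mx map_mx0 -/f -/B BE.
rewrite horner_mx_uconjC // horner_mx_diag.
suff -> : map_mx (horner (map_poly f p)) D = 0.
  by rewrite linear0 mulmx0 mul0mx.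
apply/rowP=> j; rewrite !mxE.
have /mxOverP /(_ 0 j) /complex_realP [r Dj] := Dr.
rewrite Dj horner_map /=; suff /rootP -> : root p r by [].
(* Row [j] of the diagonalising matrix is an eigenvector for [r], nonzero because [P] is invertible;
   the eigenvalue then descends from the complex extension to [R]. *)
apply: Ap; rewrite -(eigenvalue_map f); apply/eigenvalueP; exists (row j P).
  rewrite -/B BE !mulmxA -row_mul mulmxV // row1 -rowE row_diag_mx Dj.
  by rewrite -scalemxAl -rowE.
apply/eqP=> Pj; have := congr1 (mulmx^~ (invmx P)) Pj.
rewrite -row_mul mulmxV // row1 mul0mx => /rowP /(_ j) /eqP.
by rewrite !mxE !eqxx oner_eq0.
Qed.

(** * Orthogonal projections *)

Lemma mulmx_tr_eq0 (R : realFieldType) m n (v : 'M[R]_(m, n)) :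
  v *m v^T = 0 -> v = 0.
Proof.
move=> vv; apply/matrixP=> i j; rewrite mxE.
have /eqP : \sum_k v i k ^+ 2 = 0.
  move/matrixP/(_ i i): vv; rewrite !mxE; apply: etrans.
  by apply: eq_bigr => k _; rewrite mxE.
rewrite psumr_eq0 => [|k _]; last exact: sqr_ge0.
by move/allP/(_ j (mem_index_enum _)); rewrite sqrf_eq0 => /eqP.
Qed.

(** The projection fixes the rows of [F], which lie in [W], and kills those of [1 - F], which are
    orthogonal to [W] by symmetry of [F]; adding the two gives equality. A vector both in [W] and
    orthogonal to [W] is orthogonal to itself, hence zero. *)
Lemma orth_proj_unique (R : realFieldType) n (W F : 'M[R]_n) :
  F^T = F -> (F <= W)%MS -> W *m F = W -> orth_proj W = F.
Proof.
move=> Fs FW WF; rewrite /orth_proj.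
have dx : (W :&: kermx W^T)%MS = 0.
  apply/eqP; rewrite -submx0; apply/rV_subP=> v; rewrite sub_capmx submx0.
  case/andP=> /submxP [u vE] /sub_kermxP vW; apply/eqP/mulmx_tr_eq0.
  by rewrite [in v^T]vE trmx_mul mulmxA vW mul0mx.
have F1 := proj_mx_id dx FW.
have /(proj_mx_0 dx) : (1%:M - F <= kermx W^T)%MS.
  apply/sub_kermxP; apply: trmx_inj.
  rewrite trmx_mul trmxK trmx0 linearB /= tr_scalar_mx Fs mulmxBr mulmx1 WF.
  exact: subrr.
by rewrite mulmxBl mul1mx F1 => /eqP; rewrite subr_eq0 => /eqP.
Qed.

(** * Lagrange interpolation and leading coefficients *)

Definition lagrange (F : fieldType) s (theta : 'I_s.+1 -> F) (i : 'I_s.+1) :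
    {poly F} :=
  (\prod_(j < s.+1 | j != i) (theta i - theta j))^-1
    *: \prod_(j < s.+1 | j != i) ('X - (theta j)%:P).

Section Lagrange.
Variables (F : fieldType) (s : nat) (theta : 'I_s.+1 -> F).
Hypothesis theta_inj : injective theta.

Lemma prod_theta_neq0 i : \prod_(j < s.+1 | j != i) (theta i - theta j) != 0.
Proof.
by apply/prodf_neq0 => j ji; rewrite subr_eq0 (inj_eq theta_inj) eq_sym.
Qed.

Lemma lagrange_node i j : (lagrange theta i).[theta j] = (i == j)%:R.
Proof.
rewrite /lagrange hornerZ horner_prod; case: eqVneq => [<-|ij].
  rewrite -[RHS](mulVf (prod_theta_neq0 i)); congr (_ * _).
  by apply: eq_bigr => k _; rewrite hornerXsubC.
by rewrite [X in _ * X](bigD1 j) 1?eq_sym //= hornerXsubC subrr mul0r mulr0.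
Qed.

Lemma size_lagrange_prod i :
  size (\prod_(j < s.+1 | j != i) ('X - (theta j)%:P)) = s.+1.
Proof.
rewrite -big_filter size_prod_XsubC -sum1_size big_filter.
by rewrite sum1_card cardC1 card_ord.
Qed.

Lemma size_lagrange i : (size (lagrange theta i) <= s.+1)%N.
Proof. by rewrite (leq_trans (size_scale_leq _ _)) // size_lagrange_prod. Qed.

Lemma coef_lagrange i :
  (lagrange theta i)`_s = (\prod_(j < s.+1 | j != i) (theta i - theta j))^-1.
Proof.
rewrite /lagrange coefZ.
have /monicP : \prod_(j < s.+1 | j != i) ('X - (theta j)%:P) \is monic.
  by rewrite rpred_prod // => j _; apply: monicXsubC.
by rewrite lead_coefE size_lagrange_prod /= => ->; rewrite mulr1.
Qed.

(** Splitting off the factor that pairs [i] with [ord0] from both denominators leaves the two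
    products whose quotient is [Kcoef]; the split factors are opposite, whence the sign. *)
Lemma lagrange_Kcoef i : i != ord0 ->
  (lagrange theta i)`_s = - ((lagrange theta ord0)`_s * Kcoef theta i).
Proof.
move=> i0; rewrite !coef_lagrange /Kcoef big_split /= prodfV.
pose P (j : 'I_s.+1) := (j != ord0) && (j != i).
set Q := \prod_(j < _ | P j) (theta ord0 - _).
have Q0 : Q != 0.
  apply/prodf_neq0 => j /andP[j0 _].
  by rewrite subr_eq0 (inj_eq theta_inj) eq_sym.
have -> : \prod_(j < s.+1 | j != ord0) (theta ord0 - theta j)
          = (theta ord0 - theta i) * Q by rewrite (bigD1 i).
have -> : \prod_(j < s.+1 | j != i) (theta i - theta j)
          = (theta i - theta ord0) * \prod_(j < s.+1 | P j) (theta i - theta j).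
  by rewrite (bigD1 ord0) 1?eq_sym //=; under eq_bigl do rewrite andbC.
by rewrite !invfM -mulrA mulKf // -mulNr -invrN opprB.
Qed.
End Lagrange.

(** * Eigenprojections as polynomials in the matrix *)

Section Spectrum.
Variables (R : rcfType) (s : nat) (theta : 'I_s.+1 -> R).
Hypothesis theta_inj : injective theta.

Lemma orth_proj_lagrange n (A : 'M[R]_n.+1) i :
  A^T = A -> (forall a, eigenvalue A a -> exists j, a = theta j) ->
  orth_proj (eigenspace A (theta i)) = horner_mx A (lagrange theta i).
Proof.
move=> As Ae; apply: orth_proj_unique.
- by rewrite horner_mx_trmx As.
(* The product of [lagrange theta i] and ['X - theta i] vanishes at every node, so it annihilates
   [A]. *)
- apply/eigenspaceP; apply/eqP; rewrite -subr_eq0 -mul_mx_scalar -mulmxBr.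
  have -> : A - (theta i)%:M = horner_mx A ('X - (theta i)%:P).
    by rewrite rmorphB /= horner_mx_X horner_mx_C.
  rewrite mulmxE -rmorphM /= (horner_mx_sym_eq0 As) // => a /Ae [j ->].
  rewrite rootE hornerM lagrange_node // hornerXsubC.
  by case: (eqVneq i j) => [->|_]; rewrite ?subrr ?mulr0 ?mul0r.
- have /(horner_mx_eigenvector (lagrange theta i)) -> :=
    eigenspaceP (submx_refl (eigenspace A (theta i))).
  by rewrite lagrange_node // eqxx scale1r.
Qed.

Section Entries.
Variables (n : nat) (A : 'M[R]_n.+1).
Hypotheses (A_sym : A^T = A)
  (A_eigen : forall a, eigenvalue A a -> exists j, a = theta j)
  (A_const : (const_mx 1 : 'rV_n.+1) *m A = theta ord0 *: const_mx 1)
  (A_simple : forall v : 'rV_n.+1,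
     v *m A = theta ord0 *: v -> forall x y, v 0 x = v 0 y).

(** Each row of [F] is an eigenvector for [theta ord0], hence constant; by symmetry so is each
    column. Since [F] fixes the all-ones row, every column sums to 1. *)
Lemma lagrange0_entry x y :
  horner_mx A (lagrange theta ord0) x y = n.+1%:R^-1.
Proof.
set F := horner_mx _ _.
have Fs : F^T = F by rewrite horner_mx_trmx A_sym.
have F1 : (const_mx 1 : 'rV_n.+1) *m F = const_mx 1.
  by rewrite (horner_mx_eigenvector _ A_const) lagrange_node // eqxx scale1r.
have FA : F *m A = theta ord0 *: F.
  rewrite /F -orth_proj_lagrange //; apply/eigenspaceP.
  by rewrite /orth_proj -[X in (X <= _)%MS]mul1mx proj_mx_sub.
have Fxy z : F z y = F x y.
  have := A_simple (v := row y F).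
  rewrite -row_mul FA linearZ /= => /(_ erefl z x).
  by rewrite !mxE -[in LHS]Fs -[in RHS]Fs !mxE.
have /rowP /(_ y) := F1; rewrite !mxE.
under eq_bigr do rewrite mxE mul1r Fxy.
rewrite sumr_const card_ord => Fn.
have n0 : n.+1%:R != 0 :> R by rewrite pnatr_eq0.
by apply: (mulIf n0); rewrite mulVf // mulr_natr.
Qed.

(** Otherwise the entry of [lagrange0_entry], a combination of these powers, would vanish. For
    graphs this bounds all distances by [s]. *)
Lemma expmx_entry_neq0 x y : exists2 m, (m <= s)%N & (A ^+ m) x y != 0.
Proof.
have [/existsP[m Am]|/existsPn A0] :=
  boolP [exists m : 'I_s.+1, (A ^+ m) x y != 0].
  by exists m; rewrite -1?ltnS.
have := lagrange0_entry x y.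
rewrite (horner_mx_sum _ (size_lagrange theta ord0)) summxE big1 => [|m _].
  by move/eqP; rewrite eq_sym invr_eq0 pnatr_eq0.
by rewrite mxE; have /negPn/eqP -> := A0 m; rewrite mulr0.
Qed.

Lemma orth_proj_entry x y i :
  (forall m, (m < s)%N -> (A ^+ m) x y = 0) -> i != ord0 ->
  orth_proj (eigenspace A (theta i)) x y = - (Kcoef theta i / n.+1%:R).
Proof.
move=> A0 i0.
(* Used for both [i] and [ord0]: the unknown entry of [A ^+ s] is eliminated by means of the known
   entry for [ord0]. *)
have top j : horner_mx A (lagrange theta j) x y
             = (lagrange theta j)`_s * (A ^+ s) x y.
  rewrite (horner_mx_sum _ (size_lagrange theta j)) big_ord_recr /= mxE.
  rewrite summxE big1 => [|m _]; first by rewrite add0r mxE.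
  by rewrite mxE A0 ?mulr0.
rewrite orth_proj_lagrange // top lagrange_Kcoef // -(lagrange0_entry x y) top.
by rewrite mulNr mulrAC [_ * Kcoef _ _]mulrC.
Qed.
End Entries.
End Spectrum.

(** * Walks and powers of the adjacency matrix *)

Lemma walkS (V : finType) (e : rel V) n x y :
  walk e n.+1 x y = [exists z, e x z && walk e n z y].
Proof.
apply/existsP/existsP => [[p]|[z /andP[xz /existsP[p /andP[pz zy]]]]].
  case/tupleP: p => z p /= /andP[/andP[xz pz] py].
  by exists z; rewrite xz; apply/existsP; exists p; rewrite pz.
by exists [tuple of z :: p]; rewrite /= xz pz.
Qed.

Lemma walk_rcons (V : finType) (e : rel V) n x y z :
  walk e n x z -> e z y -> walk e n.+1 x y.
Proof.
case/existsP=> p /andP[pz /eqP xz] zy; apply/existsP.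
by exists [tuple of rcons p y]; rewrite /= rcons_path last_rcons pz xz zy /=.
Qed.

Lemma walk0 (V : finType) (e : rel V) x y : walk e 0 x y = (x == y).
Proof.
apply/existsP/eqP => [[p]|->]; first by rewrite [p]tuple0 => /eqP.
by exists [tuple]; rewrite /= eqxx.
Qed.

Lemma walk_last (V : finType) (e : rel V) n x y :
  walk e n.+1 x y -> exists2 z, walk e n x z & e z y.
Proof.
elim: n x => [|n IH] x; rewrite walkS => /existsP[z /andP[xz]].
  by rewrite walk0 => /eqP <-; exists x; rewrite ?walk0.
case/IH=> w zw wy; exists w => //.
by rewrite walkS; apply/existsP; exists z; rewrite xz.
Qed.

Lemma expmx_adjacency_eq0 (R : fieldType) (V : finType) (e : rel V) n x y :
  ~~ walk e n x y -> (adjacency R e ^+ n) (enum_rank x) (enum_rank y) = 0.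
Proof.
elim: n x => [|n IH] x nw.
  by move: nw; rewrite walk0 mxE (inj_eq enum_rank_inj) => /negPf ->.
rewrite exprS mxE big1 // => i _; rewrite mxE enum_rankK.
case xz: (e x (enum_val i)); last by rewrite mul0r.
rewrite -[i in X in _ * X]enum_valK IH ?mulr0 //; apply: contra nw => zy.
by rewrite walkS; apply/existsP; exists (enum_val i); rewrite xz.
Qed.

(** * The eigenvalue [k] of a connected regular graph *)

Lemma adjacency_sym (R : fieldType) (V : finType) (e : rel V) :
  symmetric e -> (adjacency R e)^T = adjacency R e.
Proof. by move=> es; apply/matrixP=> i j; rewrite !mxE es. Qed.

Lemma sum_adjacency (R : fieldType) (V : finType) (e : rel V) k i :
  regular e k -> \sum_j adjacency R e i j = k%:R.
Proof.
move=> er; rewrite (reindex _ (onW_bij _ (@enum_rank_bij V))) /=.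
have <- : \sum_(y | e (enum_val i) y) 1 = k%:R :> R.
  by rewrite -(er (enum_val i)) sumr_const cardsE.
rewrite [RHS]big_mkcond /=.
by apply: eq_bigr => y _; rewrite mxE enum_rankK; case: (e _ y).
Qed.

(* A k-eigenvector makes the sum of (v x - v y)^2 over all edges vanish. *)
Lemma adjacency_eigenvector_const (R : realFieldType) (V : finType)
    (e : rel V) k (v : 'rV[R]_#|V|) :
  symmetric e -> connected e -> regular e k ->
  v *m adjacency R e = k%:R *: v -> forall x y, v 0 x = v 0 y.
Proof.
move=> es [_ ec] er vA; set A := adjacency R e in vA.
have /eqP : \sum_i \sum_j A i j * (v 0 i - v 0 j) ^+ 2 = 0.
  have vAi j : \sum_i v 0 i * A i j = k%:R * v 0 j.
    by move/rowP/(_ j): vA; rewrite !mxE.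
  have As i j : A i j = A j i by rewrite !mxE es.
  (* After expansion of the square, regularity turns each outer sum into [k] times the squared norm
     of [v], and the eigenvector equation turns the cross term into minus twice that. *)
  have -> : \sum_i \sum_j A i j * (v 0 i - v 0 j) ^+ 2
    = \sum_i (\sum_j A i j) * v 0 i ^+ 2
      - (\sum_j (\sum_i v 0 i * A i j) * v 0 j) *+ 2
      + \sum_j (\sum_i A i j) * v 0 j ^+ 2.
    under [X in _ = X - _ + _]eq_bigr do rewrite mulr_suml.
    under [X in _ = _ - X *+ 2 + _]eq_bigr do rewrite mulr_suml.
    under [X in _ = _ - _ + X]eq_bigr do rewrite mulr_suml.
    rewrite [X in _ = _ - X *+ 2 + _]exchange_big /=.
    rewrite [X in _ = _ + X]exchange_big /=.
    rewrite -sumrMnl -sumrN -!big_split; apply: eq_bigr => i _ /=.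
    rewrite -sumrMnl -sumrN -!big_split; apply: eq_bigr => j _ /=.
    ring.
  have s1 i : \sum_j A i j = k%:R by apply: sum_adjacency.
  have s2 j : \sum_i A i j = k%:R by rewrite -(s1 j); apply: eq_bigr.
  under eq_bigr do rewrite s1.
  under [X in _ - X *+ 2]eq_bigr do rewrite vAi -mulrA -expr2.
  under [X in _ + X]eq_bigr do rewrite s2.
  by rewrite mulr2n addrAC subrr.
have A0 i j : 0 <= A i j * (v 0 i - v 0 j) ^+ 2.
  by rewrite mulr_ge0 ?sqr_ge0 // mxE ler0n.
rewrite psumr_eq0 => [/allP v0|i _]; last by apply: sumr_ge0.
have {}v0 x y : e x y -> v 0 (enum_rank x) = v 0 (enum_rank y).
  move=> xy; have := v0 (enum_rank x) (mem_index_enum _).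
  rewrite /= psumr_eq0 //.
  move/allP/(_ (enum_rank y) (mem_index_enum _)).
  by rewrite mxE !enum_rankK xy mul1r sqrf_eq0 subr_eq0 => /eqP.
suff vc x y : v 0 (enum_rank x) = v 0 (enum_rank y).
  by move=> i j; have := vc (enum_val i) (enum_val j); rewrite !enum_valK.
have /connectP [p + ->] := ec x y.
by elim: p x => //= z p IH x /andP[xz zp]; rewrite (v0 _ _ xz); apply: IH.
Qed.

(** * Distances, shells and the Moore bound *)

Section Distance.
Variables (V : finType) (e : rel V).

Lemma dist_le_walk n x y : walk e n x y -> (dist e x y <= n)%N.
Proof.
move=> w; rewrite leqNgt; apply/negP=> lt_n; move: (lt_n).
(* [dist] never exceeds [#|V|], so [n] lies in the range searched by [find]. *)
have ltV : (n < #|V|)%N.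
  by rewrite (leq_trans lt_n) // -[X in (_ <= X)%N](size_iota 0) find_size.
by move/(before_find 0); rewrite nth_iota // w.
Qed.

Lemma dist_lt_card x y : connect e x y -> (dist e x y < #|V|)%N.
Proof.
case/connectP=> p xp ->; case/shortenP: xp => q xq uq _.
apply: (@leq_ltn_trans (size q)).
  apply/dist_le_walk/existsP.
  by exists (in_tuple q); rewrite /= xq eqxx.
by rewrite -[(size q).+1]/(size (x :: q)) -(card_uniqP uq) max_card.
Qed.

Lemma walk_dist x y : connect e x y -> walk e (dist e x y) x y.
Proof.
move/dist_lt_card=> ltV; have ltV' := ltV.
rewrite -[X in (_ < X)%N](size_iota 0) -has_find in ltV'.
by have := nth_find 0 ltV'; rewrite nth_iota.
Qed.

Hypothesis e_conn : forall x y, connect e x y.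

(** The vertex before the last on a shortest walk works: were it closer to [x], adding the last edge
    would give a shorter walk to [y]. *)
Lemma dist_pred x y n : dist e x y = n.+1 -> exists2 z, dist e x z = n & e z y.
Proof.
move=> xy; have := walk_dist (e_conn x y); rewrite xy => /walk_last [z xz zy].
exists z => //; apply/eqP; rewrite eqn_leq dist_le_walk //= -ltnS -xy.
by apply: dist_le_walk; apply: walk_rcons zy; apply: walk_dist.
Qed.

Definition shell (x : V) (n : nat) := [set y | dist e x y == n].

(** By [dist_pred], the neighbours of the vertices of one shell cover the next shell. *)
Lemma card_shellS x n b :
  (forall z, z \in shell x n ->
     (#|[set y | e z y] :&: shell x n.+1| <= b)%N) ->
  (#|shell x n.+1| <= #|shell x n| * b)%N.
Proof.
move=> zb.
have sub : shell x n.+1 \subset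
    \bigcup_(z in shell x n) ([set y | e z y] :&: shell x n.+1).
  apply/subsetP=> y; rewrite inE => /eqP xy; have [z xz zy] := dist_pred xy.
  by apply/bigcupP; exists z; rewrite !inE ?xz ?zy ?xy eqxx.
rewrite (leq_trans (subset_leq_card sub)) //.
rewrite -sum_nat_const; pose S z := [set y | e z y] :&: shell x n.+1.
apply: (@leq_trans (\sum_(z in shell x n) #|S z|)); last exact: leq_sum.
elim/big_rec2: _ => [|z m A _ IH]; first by rewrite cards0.
by rewrite (leq_trans (leq_card_setU _ _)) // leq_add2l.
Qed.

Variable k : nat.
Hypotheses (e_sym : symmetric e) (e_reg : regular e k).

Lemma card_shell0 x : (#|shell x 0| <= 1)%N.
Proof.
rewrite -(cards1 x) subset_leq_card //; apply/subsetP=> y.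
rewrite !inE => /eqP xy; have := walk_dist (e_conn x y).
by rewrite xy walk0 eq_sym.
Qed.

Lemma card_shell x n : (#|shell x n.+1| <= k * (k - 1) ^ n)%N.
Proof.
elim: n => [|n IH].
  rewrite expn0 muln1 -[X in (_ <= X)%N]mul1n.
  rewrite (leq_trans (card_shellS (b := k) _)) ?leq_mul2r ?card_shell0 ?orbT //.
  by move=> z _; rewrite -(e_reg z) subset_leq_card ?subsetIl.
rewrite expnSr mulnA; apply: leq_trans (card_shellS (b := (k - 1)%N) _) _;
  last by rewrite leq_mul2r IH orbT.
move=> z; rewrite inE => /eqP xz; have [w xw wz] := dist_pred xz.
(* The predecessor w of z is a neighbour of z outside the next shell. *)
have := cardsD1 w [set y | e z y]; rewrite e_reg inE e_sym wz => ->.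
rewrite add1n subn1 /= subset_leq_card //; apply/subsetP=> y.
rewrite !inE => /andP[zy /eqP xy]; rewrite zy andbT.
by apply: contra_eq_neq xy => ->; rewrite xw; apply/eqP; lia.
Qed.

(** The increments of [moore] are the shell bounds of [card_shell]. *)
Lemma card_ball x n : (#|[set y | (dist e x y <= n)%N]| <= moore k n)%N.
Proof.
elim: n => [|n IH].
  rewrite /moore big_ord0 muln0 addn0 (leq_trans _ (card_shell0 x)) //.
  by apply: subset_leq_card; apply/subsetP=> y; rewrite !inE leqn0.
have -> : moore k n.+1 = (moore k n + k * (k - 1) ^ n)%N.
  by rewrite /moore big_ord_recr mulnDr addnA.
apply: leq_trans (leq_add IH (card_shell x n)).
rewrite (leq_trans _ (leq_card_setU _ _)) // subset_leq_card //.
by apply/subsetP=> y; rewrite !inE leq_eqVlt orbC.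
Qed.
End Distance.

(** * Combination of the spectral and counting bounds *)

Theorem theorem2p2 (R : rcfType) (d k s : nat) (V : finType) (e : rel V)
    (theta : 'I_s.+1 -> R)
    (d_ge1 : (1 <= d)%N)
    (e_sym : symmetric e) (e_irr : irreflexive e)
    (e_conn : connected e) (e_reg : regular e k)
    (theta_eigen : forall a : R,
       eigenvalue (adjacency R e) a <-> exists i, a = theta i)
    (theta_decr : forall i j : 'I_s.+1, (i < j)%N -> theta j < theta i)
    (theta_0 : theta ord0 = k%:R)
    (s_le_d : (s <= d)%N)
    (V_large : (moore k (d - 1) < #|V|)%N) :
  [/\ diameter e = d,
      s = d,
      (forall (x y : V) (i : 'I_s.+1), dist e x y = d -> i != ord0 ->
         eigenproj e (theta i) x y = - (Kcoef theta i / #|V|%:R))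
    & (forall (x : V) (i : 'I_s.+1), i != ord0 ->
         (#|V| - moore k (d - 1)
          <= #|[set y | eigenproj e (theta i) x y
                        == - (Kcoef theta i / #|V|%:R)]|)%N)].
Proof.
have theta_inj : injective theta.
  move=> i j eq_ij; apply: val_inj.
  by case: (ltngtP i j) => // /theta_decr; rewrite eq_ij ltxx.
have spectral x y : let A := adjacency R e in
    (exists2 m, (m <= s)%N & (A ^+ m) x y != 0) /\
    (forall i, (forall m, (m < s)%N -> (A ^+ m) x y = 0) -> i != ord0 ->
     orth_proj (eigenspace A (theta i)) x y = - (Kcoef theta i / #|V|%:R)).
  have As := adjacency_sym R e_sym.
  have Ae a : eigenvalue (adjacency R e) a -> exists j, a = theta j.
    by move/theta_eigen.
  have A1 : (const_mx 1 : 'rV_#|V|) *m adjacency R e = theta ord0 *: const_mx 1.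
    apply/rowP=> j; rewrite !mxE mulr1 theta_0 -(sum_adjacency R j e_reg).
    by apply: eq_bigr => i _; rewrite -[in RHS]As !mxE mul1r.
  have Av (v : 'rV_#|V|) : v *m adjacency R e = theta ord0 *: v ->
      forall x y, v 0 x = v 0 y.
    by rewrite theta_0; apply: adjacency_eigenvector_const.
  (* Generalising the matrix and the indices lets [#|V|] be replaced by [n.+1], the shape of the
     spectral lemmas; size 0 has no index. *)
  move: (adjacency R e) x y As Ae A1 Av.
  case: #|V| => [|n] A x y As Ae A1 Av; first by case: x.
  split; first exact: (expmx_entry_neq0 theta_inj As Ae A1 Av).
  by move=> i; exact: (orth_proj_entry theta_inj As Ae A1 Av).
have dist_le_s x y : (dist e x y <= s)%N.
  have [[m ms Am] _] := spectral (enum_rank x) (enum_rank y).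
  apply: leq_trans ms; apply: dist_le_walk; apply: contraNT Am => nw.
  by rewrite expmx_adjacency_eq0.
(* These vertices form the complement of the ball of radius [d - 1]. *)
have far x : (#|V| - moore k (d - 1) <= #|[set y | (d <= dist e x y)%N]|)%N.
  rewrite leq_subLR -(cardsC [set y | (dist e x y <= d - 1)%N]).
  rewrite leq_add ?(card_ball e_conn.2) // subset_leq_card //.
  by apply/subsetP=> y; rewrite !inE; lia.
have /card_gt0P [x0 _] := e_conn.1.
have [y0] : exists y, y \in [set y | (d <= dist e x0 y)%N].
  by apply/card_gt0P; apply: leq_trans (far x0); rewrite subn_gt0.
rewrite inE => dy0.
have sd : s = d.
  by apply/eqP; rewrite eqn_leq s_le_d (leq_trans dy0).
(* Conclusions (3) and (4) both follow from this: as [s = d], a nonzero entry of a power below [s]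
   would give a walk shorter than the distance. *)
have proj x y i : (d <= dist e x y)%N -> i != ord0 ->
    eigenproj e (theta i) x y = - (Kcoef theta i / #|V|%:R).
  move=> dxy i0; have [_ H] := spectral (enum_rank x) (enum_rank y).
  apply: H => // m ms; apply: expmx_adjacency_eq0; apply/negP=> /dist_le_walk.
  by lia.
split=> //.
- apply/eqP; rewrite eqn_leq; apply/andP; split.
    by apply/bigmax_leqP=> x _; apply/bigmax_leqP=> y _; rewrite -sd.
  apply: leq_trans dy0 (leq_trans _ (leq_bigmax x0)).
  exact: (leq_bigmax y0).
- by move=> x y i xy; apply: proj; rewrite xy.
- move=> x i i0; apply: leq_trans (far x) _.
  by apply: subset_leq_card; apply/subsetP=> y; rewrite !inE => /proj ->.
Qed.
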